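(* Let $C_n$ be the cycle on $n$ vertices, where $n\geq 5$, and let $k,t$ be positive integers. If $2\leq k\leq 1+\lfloor \frac{n}{2}\rfloor$, then $\rho'(C_n^k)=2$. Moreover, when $t\leq \lfloor \frac{n}{2}\rfloor$, we have $\rho(C_n^t)=3$.
   Context: $G^k$ denotes the $k$-th Cartesian power of $G$: $G^1=G$ and $G^k=G\square G^{k-1}$, where $\square$ is the Cartesian product of graphs. A vertex (or edge) coloring of a graph is distinguishing if no automorphism other than the identity preserves it. $D(G)$ (resp. $D'(G)$) is the least number of colors in a distinguishing vertex (resp. edge) coloring of $G$. When $D(G)=2$, the cost of distinguishing $\rho(G)$ is the minimum number of vertices in the smaller color class over all distinguishing vertex colorings of $G$ with two colors. When $D'(G)=2$, the cost of edge-distinguishing $\rho'(G)$ is the minimum number of edges in the smaller color class over all distinguishing edge colorings of $G$ with two colors.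
   Formalization: The claim ρ(C_n^t)=3 is proved for all t ≤ ⌊n/2⌋ except the single pair n=5, t=1, where it fails: C_5 has no distinguishing 2-coloring (D(C_5)=3), so ρ(C_5) is undefined. *)

(* Defs.v *)
From mathcomp Require Import all_boot all_fingroup.

Set Implicit Arguments.
Unset Strict Implicit.
Unset Printing Implicit Defensive.

Record sgraph := SGraph {
  vertex :> finType;
  adj : rel vertex;
  adj_sym : symmetric adj;
  adj_irr : irreflexive adj
}.

(* For n = 1 the cyclic successor would give a loop, hence the conjunct
   [i != j]; it is redundant as soon as n >= 2. *)
Section Cycle.
Variable n : nat.

Definition cycle_adj : rel 'I_n :=
  [rel i j | (i != j) && ((ordS i == j) || (ordS j == i))].

Lemma cycle_adj_sym : symmetric cycle_adj.
Proof. by move=> i j; rewrite /cycle_adj /= eq_sym orbC. Qed.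

Lemma cycle_adj_irr : irreflexive cycle_adj.
Proof. by move=> i; rewrite /cycle_adj /= eqxx. Qed.

Definition cycle_graph : sgraph := SGraph cycle_adj_sym cycle_adj_irr.
End Cycle.

Section CartesianProduct.
Variables G H : sgraph.

Definition cprod_adj : rel (G * H) :=
  [rel u v | (u.1 == v.1) && adj u.2 v.2 || adj u.1 v.1 && (u.2 == v.2)].

Lemma cprod_adj_sym : symmetric cprod_adj.
Proof.
move=> u v; rewrite /cprod_adj /= (eq_sym u.1) (eq_sym u.2).
by rewrite (@adj_sym G u.1) (@adj_sym H u.2).
Qed.

Lemma cprod_adj_irr : irreflexive cprod_adj.
Proof. by move=> u; rewrite /cprod_adj /= !adj_irr andbF. Qed.

Definition cprod : sgraph := SGraph cprod_adj_sym cprod_adj_irr.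
End CartesianProduct.

(* Meaningful for k >= 1 only: G^1 = G and G^k = G [] G^(k-1); the value at
   k = 0 is junk. *)
Definition cpower (G : sgraph) (k : nat) : sgraph := iter k.-1 (cprod G) G.

Section Distinguishing.
Variable G : sgraph.

Definition automorphism (s : {perm G}) : Prop :=
  forall x y : G, adj (s x) (s y) = adj x y.

Definition edges : {set {set G}} :=
  [set e | [exists x, exists y, adj x y && (e == [set x; y])]].

Definition distinguishing k (c : {ffun G -> 'I_k}) : Prop :=
  forall s : {perm G}, automorphism s ->
    (forall x, c (s x) = c x) -> s = 1%g.

(* An edge coloring is a function on all sets of vertices of which only the
   values on [edges] are ever used. *)
Definition edge_distinguishing k (c : {ffun {set G} -> 'I_k}) : Prop :=
  forall s : {perm G}, automorphism s ->
    (forall e, e \in edges -> c (s @: e) = c e) -> s = 1%g.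

Definition smaller_class (c : {ffun G -> 'I_2}) : nat :=
  minn #|[set x | c x == ord0]| #|[set x | c x == ord_max]|.

Definition smaller_edge_class (c : {ffun {set G} -> 'I_2}) : nat :=
  minn #|[set e in edges | c e == ord0]| #|[set e in edges | c e == ord_max]|.
End Distinguishing.

Definition least (P : nat -> Prop) (m : nat) : Prop :=
  P m /\ forall j, P j -> m <= j.

(* The invariants are partial, so they are rendered as relations:
   [is_D G d] reads D(G) = d, [is_D' G d] reads D'(G) = d, [is_rho G m] reads
   "rho(G) is defined and equal to m", and similarly for [is_rho']. *)
Definition is_D (G : sgraph) : nat -> Prop :=
  least (fun k => exists c : {ffun G -> 'I_k}, distinguishing c).

Definition is_D' (G : sgraph) : nat -> Prop :=
  least (fun k => exists c : {ffun {set G} -> 'I_k}, edge_distinguishing c).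

Definition is_rho (G : sgraph) (m : nat) : Prop :=
  is_D G 2 /\
  least (fun j => exists2 c : {ffun G -> 'I_2},
                    distinguishing c & smaller_class c = j) m.

Definition is_rho' (G : sgraph) (m : nat) : Prop :=
  is_D' G 2 /\
  least (fun j => exists2 c : {ffun {set G} -> 'I_2},
                    edge_distinguishing c & smaller_edge_class c = j) m.

(* Main.v *)
Require Import Defs.
From mathcomp Require Import all_boot all_fingroup all_algebra.
From mathcomp Require Import zify ring.

(* The k-th power of C_n is the Cayley graph of (Z_n)^k for the vectors
   +-delta_i.  For n >= 5 the only relations a + b = c + d between four such
   vectors are the trivial ones, so an automorphism g preserves squares; hence
   g (x + a) - g x does not depend on x, and g is affine, with a signed
   permutation of the coordinates as linear part.
   Lower bounds: the point reflection x |-> p + q - x swaps p and q, so it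
   preserves any two vertices p, q, and any edge {p, q}.
   Upper bounds: in coordinates, the vertices 0, (1, 2, .., t), (0, 1, .., t-1)
   for t >= 2 and 0, 1, 3 for t = 1 have a trivial stabilizer, and so do the
   two edges from 0 in direction 0 and from (0, 1, 1, 2, .., k-2) in
   direction 1. *)

Set Implicit Arguments.
Unset Strict Implicit.
Unset Printing Implicit Defensive.

Import GRing.Theory.
Local Open Scope ring_scope.

(** * Signed basis vectors *)

Definition unit_vec (R : nzRingType) k (a : 'rV[R]_k) : bool :=
  [exists i, (a == delta_mx 0 i) || (a == - delta_mx 0 i)].

Lemma unit_vecP (R : nzRingType) k (a : 'rV[R]_k) :
  reflect (exists i, exists b : bool, a = (-1) ^+ b *: delta_mx 0 i) (unit_vec a).
Proof.
apply: (iffP existsP) => [[i /orP[]/eqP->]|[i [[] ->]]]; exists i.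
- by exists false; rewrite scale1r.
- by exists true; rewrite scaleN1r.
- by rewrite scaleN1r eqxx orbT.
- by rewrite scale1r eqxx.
Qed.

Lemma unit_vecN (R : nzRingType) k (a : 'rV[R]_k) : unit_vec (- a) = unit_vec a.
Proof. by apply: eq_existsb => i; rewrite eqr_oppLR eqr_opp orbC. Qed.

Lemma unit_vec_delta (R : nzRingType) k i : unit_vec (delta_mx 0 i : 'rV[R]_k).
Proof. by apply/existsP; exists i; rewrite eqxx. Qed.

(** The support of a signed basis vector lies in one block; this mirrors the two disjuncts of
    adjacency in a Cartesian product. *)
Lemma unit_vec_row_mx (R : nzRingType) k l (a : 'rV[R]_k) (b : 'rV[R]_l) :
  unit_vec (row_mx a b) = unit_vec a && (b == 0) || (a == 0) && unit_vec b.
Proof.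
have delta0 r (i : 'I_r) (e : bool) : (-1) ^+ e *: delta_mx 0 i != 0 :> 'rV[R]_r.
  apply/eqP => /(congr1 (fun x : 'rV_r => x 0 i)); rewrite !mxE !eqxx mulr1.
  by move/eqP; rewrite signr_eq0.
apply/unit_vecP/idP => [[i [e]]|].
  rewrite -(splitK i); case: (split i) => j /=.
    rewrite delta_mx_lshift scale_row_mx scaler0 => /eq_row_mx[-> ->].
    by rewrite eqxx andbT; apply/orP; left; apply/unit_vecP; exists j, e.
  rewrite delta_mx_rshift scale_row_mx scaler0 => /eq_row_mx[-> ->].
  by rewrite eqxx; apply/orP; right; apply/unit_vecP; exists j, e.
case/orP => /andP[].
  move=> /unit_vecP[j [e ->]] /eqP->; exists (lshift l j), e.
  by rewrite delta_mx_lshift scale_row_mx scaler0.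
move=> /eqP-> /unit_vecP[j [e ->]]; exists (rshift k j), e.
by rewrite delta_mx_rshift scale_row_mx scaler0.
Qed.

(** * Coordinates on powers of a cycle, and arithmetic modulo n up to sign *)

Section Zn.
Variable m : nat.
Local Notation R := 'I_m.+2.

Lemma Zn_natr_eq0 a : ((a%:R : R) == 0) = (m.+2 %| a)%N.
Proof. by rewrite Zp_nat -val_eqE. Qed.

Lemma cycle_adjE (i j : R) : cycle_adj i j = (i - j == 1) || (i - j == -1).
Proof.
have ordSE (l : R) : ordS l = l + 1.
  by apply: val_inj; rewrite /= (@modn_small 1) // addn1.
rewrite /cycle_adj /= !ordSE.
rewrite -(eqr_opp (i - j) (-1)) opprK opprB !subr_eq.
rewrite orbC (addrC 1 i) (addrC 1 j) ![_ + 1 == _]eq_sym andb_idl //.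
by case/orP => /eqP->; rewrite ?[_ == _ + 1]eq_sym addrC -subr_eq0 addrK oner_eq0.
Qed.

Lemma unit_vec_const1 (x y : R) :
  unit_vec (const_mx x - const_mx y : 'rV[R]_1) = cycle_adj x y.
Proof.
rewrite cycle_adjE; apply/unit_vecP/orP => [[i [e]]|].
  move=> /(congr1 (fun a : 'rV_1 => a 0 i)); rewrite !mxE !eqxx mulr1 => ->.
  by case: e; [right|left].
have E (e : bool) : x - y = (-1) ^+ e ->
    const_mx x - const_mx y = (-1) ^+ e *: delta_mx 0 0 :> 'rV[R]_1.
  by move=> xy; apply/rowP => i; rewrite !mxE ord1 eqxx mulr1.
case=> /eqP xy; first by exists 0, false; apply: E.
by exists 0, true; apply: E.
Qed.

(** Induction on the power: each new factor contributes one coordinate in front, and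
    [unit_vec_row_mx] matches the adjacencies. *)
Lemma cpower_cycle_coords k :
  exists2 f : cpower (cycle_graph m.+2) k.+1 -> 'rV[R]_k.+1,
    bijective f & forall x y, adj x y = unit_vec (f x - f y).
Proof.
elim: k => [|k [f [f' fK f'K] f_adj]].
  exists (fun x : R => const_mx x); last by move=> x y; rewrite unit_vec_const1.
  exists (fun a : 'rV_1 => a 0 0) => [x|a]; first by rewrite mxE.
  by apply/rowP => i; rewrite mxE ord1.
exists (fun u : R * cpower (cycle_graph m.+2) k.+1 =>
  row_mx (const_mx u.1 : 'rV_1) (f u.2)).
  exists (fun a : 'rV[R]_(1 + k.+1) => (lsubmx a 0 0, f' (rsubmx a))) => [[x u]|a].
    by rewrite /= row_mxKl row_mxKr mxE fK.
  rewrite /= f'K -[RHS]hsubmxK; congr row_mx.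
  by apply/rowP => i; rewrite mxE ord1.
move=> [x u] [y v]; rewrite /= /cprod_adj /=.
have row_mxB (a c : 'rV[R]_1) (b d : 'rV[R]_k.+1) :
    row_mx a b - row_mx c d = row_mx (a - c) (b - d).
  by rewrite opp_row_mx add_row_mx.
rewrite [RHS](congr1 (@unit_vec R _) (row_mxB _ _ _ _)).
rewrite unit_vec_row_mx unit_vec_const1 f_adj !subr_eq0.
rewrite (can_eq fK) orbC; congr (_ || _ && _).
by apply/eqP/eqP => [->|/rowP/(_ 0)]; rewrite ?mxE.
Qed.

(** For the minus sign, n divides [a + b], which is at most n: both numbers are 0 or both are
    n/2. *)
Lemma sign_natr_inj a b (e : bool) :
  (a <= m.+2./2)%N -> (b <= m.+2./2)%N -> a%:R = (-1) ^+ e * b%:R :> R -> a = b.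
Proof.
move=> ha hb; case: e; last first.
  rewrite mul1r => /(congr1 val); rewrite -[LHS]/(nat_of_ord _) -[RHS]/(nat_of_ord _).
  rewrite !(@val_Zp_nat m.+2) // !modn_small //; lia.
rewrite mulN1r => /eqP; rewrite -addr_eq0 -natrD Zn_natr_eq0.
case: (posnP (a + b)) => [|ab0 /(dvdn_leq ab0)]; lia.
Qed.

Lemma sign_natr_eq a (e : bool) :
  (0 < a)%N -> (a.*2 < m.+2)%N -> a%:R = (-1) ^+ e * a%:R :> R -> e = false.
Proof.
case: e => // a0 ha; rewrite mulN1r => /eqP.
rewrite -addr_eq0 -natrD Zn_natr_eq0 => /dvdn_leq; lia.
Qed.

(** With truncated subtraction, [a - b + (b - a)] is the distance |a - b|; up to half of n it can be
    read off modulo n and up to sign. *)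
Lemma sign_natr_sub a b c (e : bool) :
  (a - b + (b - a) <= m.+2./2)%N -> (c <= m.+2./2)%N ->
  a%:R - b%:R = (-1) ^+ e * c%:R :> R -> (a - b + (b - a))%N = c.
Proof.
have [le_ba|/ltnW le_ab] := leqP b a => hab hc.
  rewrite -natrB // => /sign_natr_inj; lia.
rewrite -opprB -natrB // => /(congr1 -%R).
rewrite opprK -mulNr -signrN => /sign_natr_inj; lia.
Qed.

Hypothesis m_ge3 : (3 <= m)%N.

(** Compare the coordinate where [a] has its entry s. Outside the three cases, [b] has 0 or s there
    and [c], [d] have 0 or -s, so one of s, 2s, 3s, 4s would vanish, which is impossible for n >=
    5. *)
Lemma unit_vec_quad k (a b c d : 'rV[R]_k) :
  unit_vec a -> unit_vec b -> unit_vec c -> unit_vec d ->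
  a + b = c + d -> [\/ b = - a, c = a | d = a].
Proof.
have nat0 l : (0 < l < 5)%N -> (l%:R == 0 :> R) = false.
  by move=> ?; rewrite Zn_natr_eq0; apply/negP => /dvdn_leq; lia.
move=> /unit_vecP[i [e ->]] hb hc hd.
have coord (e' : bool) (x : 'rV[R]_k) : unit_vec x ->
    x = (-1) ^+ e' *: delta_mx 0 i \/ x 0 i = 0 \/ x 0 i = - (-1) ^+ e'.
  case/unit_vecP => j [e'' ->]; rewrite !mxE eqxx /=.
  case: (eqVneq i j) => [->|_]; last by rewrite mulr0; auto.
  rewrite mulr1; case: (eqVneq e'' e') => [->|]; first by left.
  by case: e' e'' => [] [] // _; right; right; rewrite ?opprK.
case: (coord (~~ e) b hb) => [->|b_i].
  by constructor 1; case: (e); rewrite ?scaleN1r ?scale1r ?opprK.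
case: (coord e c hc) => [->|c_i]; first by constructor 2.
case: (coord e d hd) => [->|d_i]; first by constructor 3.
move=> /(congr1 (fun x : 'rV_k => x 0 i)); rewrite !mxE !eqxx mulr1.
set s := (-1) ^+ e in b_i c_i d_i *.
have s_nat l : (0 < l < 5)%N -> s * l%:R = 0 -> False.
  by rewrite /s; case: (e) => hl /eqP; rewrite ?mulN1r ?mul1r ?oppr_eq0 nat0.
have {}b_i : b 0 i = 0 \/ b 0 i = s.
  by move: b_i; rewrite /s; case: (e); rewrite ?opprK.
move=> /eqP; rewrite -subr_eq0 => /eqP sum0; exfalso.
case: b_i c_i d_i sum0 => -> [] -> [] -> sum0;
  [apply: (s_nat 1%N)|apply: (s_nat 2)|apply: (s_nat 2)|apply: (s_nat 3)
  |apply: (s_nat 2)|apply: (s_nat 3)|apply: (s_nat 3)|apply: (s_nat 4)] => //;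
  by rewrite -[RHS]sum0; ring.
Qed.

Lemma unit_vec_neqN k (a : 'rV[R]_k) : unit_vec a -> a != - a.
Proof.
case/unit_vecP => i [e ->]; rewrite -addr_eq0 -scalerDl; apply/eqP.
move=> /(congr1 (fun x : 'rV_k => x 0 i)); rewrite !mxE !eqxx mulr1 => /eqP.
by case: e; rewrite -?opprD ?oppr_eq0 -(natrD _ 1 1) Zn_natr_eq0 => /dvdn_leq; lia.
Qed.

(** Every entry is the class of a natural number, so every vector is a sum of basis vectors: this is
    induction along walks from 0. *)
Lemma unit_vec_ind k (P : 'rV[R]_k -> Prop) :
  P 0 -> (forall x a, unit_vec a -> P x -> P (x + a)) -> forall x, P x.
Proof.
move=> P0 PD x; rewrite (matrix_sum_delta x) big_ord1.
elim/big_rec: _ => // i y _ Py; rewrite -[x _ _]natr_Zp scaler_nat addrC.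
elim: (nat_of_ord _) => [|l IHl]; first by rewrite mulr0n addr0.
by rewrite mulrSr addrA; apply: PD => //; apply: unit_vec_delta.
Qed.

(** * Automorphisms of the torus are affine *)

Section Automorphism.
Variables (k : nat) (g : 'rV[R]_k -> 'rV[R]_k).
Hypothesis g_inj : injective g.
Hypothesis g_unit : forall x y, unit_vec (g x - g y) = unit_vec (x - y).

Let step_unit x a : unit_vec a -> unit_vec (g (x + a) - g x).
Proof. by rewrite g_unit addrC addKr. Qed.

(** The image of the square x, x + a, x + a + b, x + b closes up, so [unit_vec_quad] applies; by
    injectivity of [g] its two other alternatives would give a = -b or a = b. *)
Let step_transport x a b : unit_vec a -> unit_vec b -> a != b -> a != - b ->
  g (x + b + a) - g (x + b) = g (x + a) - g x.
Proof.
move=> ua ub neq_ab neq_aNb.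
have sq : (g (x + a) - g x) + (g (x + b + a) - g (x + a))
        = (g (x + b) - g x) + (g (x + b + a) - g (x + b)).
  by rewrite ![_ - g x + _]addrC !subrKA.
have uba : unit_vec (g (x + b + a) - g (x + a)) by rewrite addrAC step_unit.
case: (unit_vec_quad (step_unit x ua) uba (step_unit x ub) (step_unit _ ua) sq) => //.
- rewrite opprB => /addIr/g_inj/eqP.
  rewrite -addrA eq_sym addrC -subr_eq0 opprD addrCA subrr addr0 oppr_eq0.
  by rewrite addrC addr_eq0 (negbTE neq_aNb).
- by move=> /addIr/g_inj/addrI/eqP; rewrite eq_sym (negbTE neq_ab).
Qed.

(** The collinear case, where no square is available: x is the only common neighbour of x + a and x
    - a. *)
Let stepN x a : unit_vec a -> g (x - a) - g x = - (g (x + a) - g x).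
Proof.
move=> ua; have uNa : unit_vec (- a) by rewrite unit_vecN.
apply/eqP/negPn/negP => /eqP neq.
have [g' gK g'K] := injF_bij g_inj.
(* If the two image steps at g x were not opposite, they would span a square; [z] is the preimage of
   its fourth corner. It is adjacent to x + a and x - a, hence equals x, against the assumption. *)
pose z := g' (g (x + a) + (g (x - a) - g x)).
have gz : g z = g (x + a) + (g (x - a) - g x) by rewrite g'K.
have uz1 : unit_vec (z - (x + a)) by rewrite -g_unit gz addrC addKr step_unit.
have uz2 : unit_vec (z - (x - a)).
  by rewrite -g_unit gz addrA addrAC addrK step_unit.
have zx : z = x -> False.
  move=> zx; apply: neq; apply/eqP; rewrite -addr_eq0 addrC addrAC -gz zx.
  by rewrite subrr.
have sq : a + (z - (x + a)) = - a + (z - (x - a)).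
  by rewrite ![_ + (z - _)]addrC opprD opprB !addrA subrK (addrAC (z + a)) addrK.
case: (unit_vec_quad ua uz1 uNa uz2 sq) => /eqP.
- by rewrite subr_eq addrC addrK => /eqP.
- by rewrite eq_sym (negbTE (unit_vec_neqN ua)).
- by rewrite subr_eq addrC subrK => /eqP.
Qed.

Let step_const x a b : unit_vec a -> unit_vec b ->
  g (x + b + a) - g (x + b) = g (x + a) - g x.
Proof.
move=> ua ub; have [->|neq_ab] := eqVneq a b.
  by apply: oppr_inj; rewrite -stepN // addrK opprB.
have [->|neq_aNb] := eqVneq a (- b); last exact: step_transport.
by rewrite addrK stepN // opprB.
Qed.

Let step0 x a : unit_vec a -> g (x + a) - g x = g a - g 0.
Proof.
move=> ua; elim/unit_vec_ind: x => [|x b ub IHx]; first by rewrite add0r.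
by rewrite step_const.
Qed.

(** Sums the steps along a walk to [y]; none of them depends on the base point. *)
Let linear_part x y : g (x + y) - g x = g y - g 0.
Proof.
elim/unit_vec_ind: y => [|y a ua IHy]; first by rewrite addr0 !subrr.
by rewrite addrA -(subrKA (g (x + y))) step0 // IHy -(step0 y ua) subrKA.
Qed.

(** The linear part sends basis vectors to signed basis vectors, which defines [sigma] and [e].
    Stating the result for differences removes the translation. *)
Lemma unit_vec_automorphism : exists (sigma : 'I_k -> 'I_k) (e : 'I_k -> bool),
  injective sigma /\
  forall x y i, (g x - g y) 0 (sigma i) = (-1) ^+ e i * (x - y) 0 i.
Proof.
pose L x := g x - g 0.
have LD x y : L (x + y) = L x + L y.
  by rewrite /L -(linear_part x y) [RHS]addrC subrKA.
have L_nat i l : L (delta_mx 0 i *+ l) = L (delta_mx 0 i) *+ l.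
  elim: l => [|l IHl]; first by rewrite /L subrr.
  by rewrite !mulrS LD IHl.
have L_delta i : exists je : 'I_k * bool, L (delta_mx 0 i) == (-1) ^+ je.2 *: delta_mx 0 je.1.
  have : unit_vec (L (delta_mx 0 i)) by rewrite g_unit subr0 unit_vec_delta.
  by case/unit_vecP => j [b ->]; exists (j, b).
pose je i := xchoose (L_delta i).
have Lje i : L (delta_mx 0 i) = (-1) ^+ (je i).2 *: delta_mx 0 (je i).1.
  exact/eqP/(xchooseP (L_delta i)).
have Lx x : L x = \sum_i x 0 i *: ((-1) ^+ (je i).2 *: delta_mx 0 (je i).1).
  rewrite {1}(matrix_sum_delta x) big_ord1.
  rewrite (big_morph L LD (subrr (g 0))); apply: eq_bigr => i _.
  by rewrite -[x _ _]natr_Zp !scaler_nat L_nat Lje.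
have LB x y : g x - g y = L (x - y).
  by rewrite /L -(linear_part y) [y + _]addrC subrK.
have LZ (b : bool) x : L ((-1) ^+ b *: x) = (-1) ^+ b *: L x.
  case: b; rewrite ?scale1r // !scaleN1r; apply/eqP.
  by rewrite -addr_eq0 -LD addNr /L subrr.
have L_inj : injective L by move=> x y /addIr/g_inj.
have sigma_inj : injective (fun i => (je i).1).
  (* If two basis vectors went to the same direction, correcting one by the product of the two signs
     would make their images equal. *)
  move=> i j eq_ij; have: L (delta_mx 0 i) = L ((-1) ^+ ((je i).2 (+) (je j).2) *: delta_mx 0 j).
    by rewrite LZ !Lje scalerA -signr_addb addbK eq_ij.
  move/L_inj/(congr1 (fun x : 'rV_k => x 0 i)); rewrite !mxE !eqxx /=.
  by case: (eqVneq i j) => // _ /eqP; rewrite mulr0 oner_eq0.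
exists (fun i => (je i).1), (fun i => (je i).2); split=> // x y i.
rewrite LB Lx summxE (bigD1 i) //= !mxE !eqxx mulr1 big1 ?addr0 1?mulrC // => j neq_ji.
by rewrite !mxE (inj_eq sigma_inj) eq_sym (negbTE neq_ji) !mulr0.
Qed.
End Automorphism.

End Zn.

(** * Costs of graphs in which any two vertices can be swapped *)

Definition swap_symmetric (G : sgraph) : Prop := forall p q : G,
  exists s : {perm G}, [/\ automorphism s, s != 1%g, s p = q & s q = p].

Section Cost.
Local Open Scope nat_scope.
Variables (G : sgraph) (x0 : G).
Hypothesis G_swap : swap_symmetric G.

(** Lets one class stand for the whole colouring: with two colours, preserving one class preserves
    both. *)
Lemma ord2_eq (a b i : 'I_2) : (a == i) = (b == i) -> a = b.
Proof.
by case: a b i => [[|[|?]] ?] [[|[|?]] ?] [[|[|?]] ?] //= h; apply: val_inj.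
Qed.

Lemma distinguishing_class_gt2 (c : {ffun G -> 'I_2}) i :
  distinguishing c -> 2 < #|[set x | c x == i]|.
Proof.
move=> c_dist; rewrite ltnNge; apply/negP => A_le2.
(* One pair handles each size: p = q for a single vertex, and any pair for the empty class. *)
have [p [q A_pq]] : exists p q, forall s : {perm G}, s p = q -> s q = p ->
    forall x, (c (s x) == i) = (c x == i).
  move: A_le2; rewrite leq_eqVlt ltnS leq_eqVlt ltnS leqn0.
  have inA x : (c x == i) = (x \in [set x | c x == i]) by rewrite inE.
  have inj (s : {perm G}) x y : (s x == s y) = (x == y) by apply: inj_eq perm_inj _ _.
  case/or3P => [/cards2P[p [q [_ defA]]]|/cards1P[p defA]|].
  - exists p, q => s spq sqp x.
    by rewrite !inA defA !inE -{1}spq -{1}sqp !inj orbC.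
  - exists p, p => s spp _ x.
    by rewrite !inA defA !inE -{1}spp inj.
  - rewrite cards_eq0 => /eqP defA; exists x0, x0 => s _ _ x.
    by rewrite !inA defA !inE.
have [s [s_aut s_neq1 spq sqp]] := G_swap p q.
case/eqP: s_neq1; apply: c_dist => // x.
exact/ord2_eq/(A_pq s spq sqp).
Qed.

Lemma edge_of_adj (x y : G) : adj x y -> [set x; y] \in edges G.
Proof.
move=> xy; rewrite inE; apply/existsP; exists x; apply/existsP; exists y.
by rewrite xy eqxx.
Qed.

Lemma imset_edge (s : {perm G}) e :
  automorphism s -> e \in edges G -> s @: e \in edges G.
Proof.
move=> s_aut; rewrite !inE => /existsP[x /existsP[y /andP[xy /eqP->]]].
apply/existsP; exists (s x); apply/existsP; exists (s y).
by rewrite s_aut xy imsetU1 imset_set1 /=.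
Qed.

(** A class with one edge survives the swap of its two ends, and an empty class survives every
    automorphism. *)
Lemma edge_distinguishing_class_gt1 (c : {ffun {set G} -> 'I_2}) i :
  edge_distinguishing c -> 1 < #|[set e in edges G | c e == i]|.
Proof.
move=> c_dist; rewrite ltnNge; apply/negP => A_le1.
have [p [q A_pq]] : exists p q, forall s : {perm G}, automorphism s ->
    s p = q -> s q = p -> forall e, e \in edges G -> (c (s @: e) == i) = (c e == i).
  move: A_le1; rewrite leq_eqVlt ltnS leqn0.
  have inA e : e \in edges G -> (c e == i) = (e \in [set e in edges G | c e == i]).
    by move=> ee; rewrite inE ee.
  case/orP => [/cards1P[e defA]|].
    have : e \in [set e in edges G | c e == i] by rewrite defA inE.
    rewrite !inE => /andP[/existsP[p /existsP[q /andP[_ /eqP def_e]]] _].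
    exists p, q => s s_aut spq sqp e' ee'.
    have se : s @: e = e by rewrite def_e imsetU1 imset_set1 spq sqp setUC.
    rewrite !inA ?imset_edge // defA !inE -{1}se.
    exact/(inj_eq (imset_inj (@perm_inj _ s))).
  rewrite cards_eq0 => /eqP defA; exists x0, x0 => s s_aut _ _ e ee.
  by rewrite !inA ?imset_edge // defA !inE.
have [s [s_aut s_neq1 spq sqp]] := G_swap p q.
case/eqP: s_neq1; apply: c_dist => // x xe.
exact/ord2_eq/(A_pq s s_aut spq sqp).
Qed.

(** The indicator of [A] is the witness for both clauses. An upper bound on the size of [A] is
    enough, as every class has more than two vertices. *)
Lemma swap_symmetric_is_rho3 (A : {set G}) : #|A| <= 3 ->
  (forall s : {perm G}, automorphism s -> {in A, forall x, s x \in A} -> s = 1%g) ->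
  is_rho G 3.
Proof.
move=> A_le3 A_rigid.
pose c : {ffun G -> 'I_2} := [ffun x => if x \in A then ord_max else ord0].
have c_dist : distinguishing c.
  move=> s s_aut s_c; apply: A_rigid => // x xA.
  by move: (s_c x); rewrite !ffunE xA; case: ifP.
split; split; first by exists c.
- move=> [|[|j]] // [c' c'_dist]; first by case: (c' x0).
  have [s [s_aut /eqP s_neq1 _ _]] := G_swap x0 x0.
  by case: s_neq1; apply: c'_dist => // x; rewrite !ord1.
- exists c => //; apply/eqP; rewrite eqn_leq leq_min.
  rewrite !distinguishing_class_gt2 // !andbT.
  apply: leq_trans (geq_minr _ _) (leq_trans _ A_le3); apply/subset_leq_card/subsetP => x.
  by rewrite inE ffunE; case: ifP.
- by move=> j [c' c'_dist <-]; rewrite leq_min !distinguishing_class_gt2.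
Qed.

Lemma swap_symmetric_is_rho'2 (A : {set {set G}}) : A \subset edges G -> #|A| <= 2 ->
  (forall s : {perm G}, automorphism s -> {in A, forall e : {set G}, s @: e \in A} -> s = 1%g) ->
  is_rho' G 2.
Proof.
move=> /subsetP A_edges A_le2 A_rigid.
pose c : {ffun {set G} -> 'I_2} := [ffun x => if x \in A then ord_max else ord0].
have c_dist : edge_distinguishing c.
  move=> s s_aut s_c; apply: A_rigid => // x xA.
  by move: (s_c x (A_edges x xA)); rewrite !ffunE xA; case: ifP.
split; split; first by exists c.
(* Colourings take a value at every set of vertices, so an empty palette fails at [set0]; a single
   colour is preserved by a nontrivial automorphism fixing [x0]. *)
- move=> [|[|j]] // [c' c'_dist]; first by case: (c' set0).
  have [s [s_aut /eqP s_neq1 _ _]] := G_swap x0 x0.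
  by case: s_neq1; apply: c'_dist => // x; rewrite !ord1.
- exists c => //; apply/eqP; rewrite eqn_leq leq_min.
  rewrite !edge_distinguishing_class_gt1 // !andbT.
  apply: leq_trans (geq_minr _ _) (leq_trans _ A_le2); apply/subset_leq_card/subsetP => x.
  by rewrite inE ffunE; case: ifP => //; rewrite andbF.
- by move=> j [c' c'_dist <-]; rewrite leq_min !edge_distinguishing_class_gt1.
Qed.
End Cost.

(** * Symmetries and rigid sets in a graph with torus coordinates *)

Section CyclePower.
Variables (m k : nat) (G : sgraph) (f : G -> 'rV['I_m.+2]_k.+1).
Hypotheses (m_ge3 : (3 <= m)%N) (f_bij : bijective f).
Hypothesis f_adj : forall x y, adj x y = unit_vec (f x - f y).

Lemma torus_swap_symmetric : swap_symmetric G.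
Proof.
have [f' fK f'K] := f_bij.
move=> p q; pose r x := f' (f p + f q - f x).
have r_inj : injective r.
  by move=> x y /(can_inj f'K)/addrI/oppr_inj/(can_inj fK).
exists (perm r_inj); split.
- move=> x y; rewrite !permE !f_adj !f'K opprB addrC subrKA.
  by rewrite -unit_vecN opprB.
- apply/eqP => /permP r1.
  (* A trivial reflection would fix every [a]; comparing a = 0 with a basis vector then gives 2 =
     0. *)
  have r_fix a : f p + f q = a + a.
    have := r1 (f' a); rewrite permE perm1 => /(can_inj f'K).
    by rewrite f'K => /eqP; rewrite subr_eq => /eqP.
  have /eqP := etrans (esym (r_fix (delta_mx 0 0))) (r_fix 0).
  by rewrite addr0 addr_eq0 (negbTE (unit_vec_neqN m_ge3 (unit_vec_delta _ _))).
- by rewrite permE /r addrC addKr fK.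
- by rewrite permE /r addrK fK.
Qed.

(** The last clause is how rigidity is proved below: trivial linear part and one fixed vertex. *)
Lemma torus_automorphism (s : {perm G}) : automorphism s ->
  exists (sigma : 'I_k.+1 -> 'I_k.+1) (e : 'I_k.+1 -> bool),
  [/\ injective sigma,
      forall x y i, (f (s x) - f (s y)) 0 (sigma i) = (-1) ^+ e i * (f x - f y) 0 i
    & sigma =1 id -> e =1 xpred0 -> (exists x, s x = x) -> s = 1%g].
Proof.
have [f' fK f'K] := f_bij.
move=> s_aut; pose g := f \o s \o f'.
have g_inj : injective g.
  by move=> x y /(can_inj fK)/perm_inj/(can_inj f'K).
have g_unit x y : unit_vec (g x - g y) = unit_vec (x - y).
  by rewrite -f_adj s_aut f_adj !f'K.
have [sigma [e [sigma_inj g_coord]]] := unit_vec_automorphism m_ge3 g_inj g_unit.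
have s_coord x y i : (f (s x) - f (s y)) 0 (sigma i) = (-1) ^+ e i * (f x - f y) 0 i.
  by have := g_coord (f x) (f y) i; rewrite /g /= !fK.
exists sigma, e; split=> // sigma1 e0 [x sx]; apply/permP => y; rewrite perm1.
apply: (can_inj fK); apply: (addIr (- f x)); apply/rowP => i.
by rewrite -{1}sx -{1}(sigma1 i) s_coord e0 mul1r.
Qed.

Lemma torus_point (a : 'rV['I_m.+2]_k.+1) : exists x, f x = a.
Proof. by have [f' _ f'K] := f_bij; exists (f' a). Qed.

Let coordB x y i : (f x - f y) 0 i = f x 0 i - f y 0 i.
Proof. by rewrite !mxE. Qed.

Let natr_neq0 a : (0 < a < m.+2)%N -> a%:R <> 0 :> 'I_m.+2.
Proof. by move=> ha /eqP; rewrite Zn_natr_eq0 => /dvdn_leq; lia. Qed.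

(** Vertices u and w share coordinate 0, while v shares no coordinate with either, so [s] fixes v;
    the entries of v - u and v - w then determine [sigma] and [e]. *)
Lemma torus_is_rho3 : (0 < k)%N -> (k < m.+2./2)%N -> is_rho G 3.
Proof.
move=> k_gt0 k_lt.
have [u fu] := torus_point 0.
have [v fv] := torus_point (\row_i (i.+1)%:R).
have [w fw] := torus_point (\row_i i%:R).
have fuE i : f u 0 i = 0 by rewrite fu mxE.
have fvE i : f v 0 i = i.+1%:R by rewrite fv mxE.
have fwE i : f w 0 i = i%:R by rewrite fw mxE.
apply: (swap_symmetric_is_rho3 u torus_swap_symmetric (A := [set u; v; w])).
  by rewrite setUC !cardsU1 cards1; lia.
move=> s s_aut s_A.
have [sigma [e [sigma_inj s_coord s_triv]]] := torus_automorphism s_aut.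
have [suA svA swA] :
    [/\ s u \in [set u; v; w], s v \in [set u; v; w] & s w \in [set u; v; w]].
  by split; apply: s_A; rewrite !inE eqxx ?orbT.
have ord_lt (j : 'I_k.+1) : (j < m.+2./2)%N by apply: leq_trans k_lt; apply: ltn_ord.
have vu_neq0 j : f v 0 j <> f u 0 j.
  by rewrite fvE fuE; apply: natr_neq0; have := ord_lt j; lia.
have vw_neq0 j : f v 0 j <> f w 0 j.
  by rewrite fvE fwE => /eqP; rewrite mulrS -subr_eq0 addrK oner_eq0.
(* Coordinate 1 exists because [0 < k]; it separates u from w. *)
pose i1 : 'I_k.+1 := inord 1.
have i1E : i1 = 1%N :> nat by rewrite inordK.
have uw_neq : s u != s w.
  rewrite (inj_eq perm_inj); apply/eqP => /(congr1 (fun x => f x 0 i1)).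
  by rewrite fuE fwE i1E => /esym/natr_neq0; apply.
have sw_su : f (s w) 0 (sigma 0) = f (s u) 0 (sigma 0).
  by apply/eqP; rewrite -subr_eq0 -coordB s_coord coordB fwE fuE subrr mulr0.
have [[su sw]|[su sw]] : s u = u /\ s w = w \/ s u = w /\ s w = u.
  move: suA swA uw_neq sw_su; rewrite !inE -!orbA.
  move=> /or3P[]/eqP-> /or3P[]/eqP->; rewrite ?eqxx //; auto; move=> _.
  - by move/vu_neq0.
  - by move/esym/vu_neq0.
  - by move/esym/vw_neq0.
  - by move/vw_neq0.
all: have sv : s v = v.
- move: svA; rewrite !inE -orbA => /or3P[]/eqP// sv.
    by move: sv; rewrite -[RHS]su => /perm_inj/(congr1 (fun x => f x 0 0))/vu_neq0.
  by move: sv; rewrite -[RHS]sw => /perm_inj/(congr1 (fun x => f x 0 0))/vw_neq0.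
(* The entries 1, .., k + 1 of v - u are at most n/2, hence distinct up to sign. *)
- have sigma_id : sigma =1 id.
    move=> i; apply: val_inj; apply: succn_inj.
    apply: (@sign_natr_inj m _ _ (e i)); try exact: ord_lt.
    by have := s_coord v u i; rewrite sv su !coordB !fuE !subr0 !fvE.
  apply: (s_triv sigma_id _ (ex_intro _ v sv)) => i.
  (* All entries of v - w are 1, so no sign can be negative. *)
  apply: (@sign_natr_eq m 1); [by []|lia|].
  have := s_coord v w i; rewrite sv sw !coordB !fvE !fwE sigma_id.
  by rewrite -!natrB ?leqnSn // subSnn.
- move: svA; rewrite !inE -orbA => /or3P[]/eqP// sv.
    by move: sv; rewrite -[RHS]sw => /perm_inj/(congr1 (fun x => f x 0 0))/vw_neq0.
  by move: sv; rewrite -[RHS]su => /perm_inj/(congr1 (fun x => f x 0 0))/vu_neq0.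
(* Swapping u and w would carry v - u, with entry 2 in coordinate 1, to v - w, whose entries are all
   1. *)
- exfalso; have := s_coord v u i1; rewrite sv su !coordB fuE subr0 !fvE fwE i1E.
  rewrite -natrB ?leqnSn // subSnn => /sign_natr_inj H; have := H _ _; lia.
Qed.

(** The points 0, 1, 3 have the distinct distances 1, 2, 3, which stay distinct around the cycle
    since 3 <= n/2. *)
Lemma torus1_is_rho3 : k = 0%N -> (4 <= m)%N -> is_rho G 3.
Proof.
move=> k0 m_ge4.
have [u fu] := torus_point 0.
have [v fv] := torus_point (const_mx 1%:R).
have [w fw] := torus_point (const_mx 3%:R).
have fuE i : f u 0 i = 0%:R by rewrite fu mxE.
have fvE i : f v 0 i = 1%:R by rewrite fv mxE.
have fwE i : f w 0 i = 3%:R by rewrite fw mxE.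
apply: (swap_symmetric_is_rho3 u torus_swap_symmetric (A := [set u; v; w])).
  by rewrite setUC !cardsU1 cards1; lia.
move=> s s_aut s_A.
have [sigma [e [sigma_inj s_coord s_triv]]] := torus_automorphism s_aut.
have [suA svA swA] :
    [/\ s u \in [set u; v; w], s v \in [set u; v; w] & s w \in [set u; v; w]].
  by split; apply: s_A; rewrite !inE eqxx ?orbT.
have f_natr x : x \in [set u; v; w] ->
    exists2 a, f x 0 0 = a%:R & [|| a == 0, a == 1 | a == 3]%N.
  by rewrite !inE -orbA => /or3P[]/eqP->; [exists 0%N|exists 1%N|exists 3].
have [a fsu a013] := f_natr _ suA.
have [b fsv b013] := f_natr _ svA.
have [c fsw c013] := f_natr _ swA.
have ord_eq (i j : 'I_k.+1) : i = j.
  by apply: val_inj; have := ltn_ord i; have := ltn_ord j; rewrite /=; lia.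
have sigma_id : sigma =1 id by move=> i; apply: ord_eq.
have s_coord0 x y : f (s x) 0 0 - f (s y) 0 0 = (-1) ^+ e 0 * (f x 0 0 - f y 0 0).
  by have := s_coord x y 0; rewrite sigma_id !coordB.
have s_dist (x y : G) (i j l : nat) : f (s x) 0 0 = i%:R -> f (s y) 0 0 = j%:R ->
    f x 0 0 - f y 0 0 = l%:R -> (maxn i j <= 3)%N -> (l <= 3)%N -> (i - j + (j - i) = l)%N.
  move=> sx sy xy ij3 l3; have := s_coord0 x y; rewrite sx sy xy => /sign_natr_sub; apply; lia.
have dba : (b - a + (a - b) = 1)%N.
  by apply: (s_dist v u) => //; rewrite ?fvE ?fuE ?subr0 //; lia.
have dca : (c - a + (a - c) = 3)%N.
  by apply: (s_dist w u) => //; rewrite ?fwE ?fuE ?subr0 //; lia.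
(* Within 0, 1, 3, distance 1 leaves {a, b} = {0, 1}, and |c - a| = 3 excludes a = 1. *)
have [a0 b1] : a = 0%N /\ b = 1%N by lia.
have f_inj x y : f x 0 0 = f y 0 0 -> x = y.
  move=> xy; apply: (bij_inj f_bij); apply/rowP => i.
  by rewrite (ord_eq i 0).
have su : s u = u by apply: f_inj; rewrite fsu fuE a0.
have e0 : e 0 = false.
  apply: (@sign_natr_eq m 1); [by []|lia|]; have := s_coord0 v u.
  by rewrite fsv fsu fvE fuE a0 b1 subr0.
apply: (s_triv sigma_id _ (ex_intro _ u su)) => i.
by rewrite (ord_eq i 0).
Qed.

(** The directions of the two edges pin down coordinates 0 and 1, so only the remaining entries of v
    must be distinct up to sign. The value 1 may therefore repeat, which allows one dimension more
    than for vertices. *)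
Lemma torus_is_rho'2 : (0 < k <= m.+2./2)%N -> is_rho' G 2.
Proof.
move=> /andP[k_gt0 k_le].
pose i1 : 'I_k.+1 := inord 1.
have i1E : i1 = 1%N :> nat by rewrite inordK.
have [u fu] := torus_point 0.
have [u' fu'] := torus_point (delta_mx 0 0).
(* This is (0, 1, 1, 2, .., k - 1): the truncated predecessor gives 0 at index 0. *)
have [v fv] := torus_point (\row_i (if i == 1%N :> nat then 1 else i.-1%:R)).
have [v' fv'] := torus_point (f v + delta_mx 0 i1).
have half_bound l : (1 < l < k.+1)%N ->
    [/\ (l.-1 <= m.+2./2)%N, (0 < l.-1)%N & (l.-1.*2 < m.+2)%N].
  by move=> ?; split; lia.
have uu' : adj u u' by rewrite f_adj fu fu' sub0r unit_vecN unit_vec_delta.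
have vv' : adj v v' by rewrite f_adj fv' opprD addrA subrr sub0r unit_vecN unit_vec_delta.
have fuE i : f u 0 i = 0 by rewrite fu mxE.
have fu'E i : f u' 0 i = (i == 0)%:R by rewrite fu' mxE.
have fvE i : f v 0 i = if i == 1%N :> nat then 1 else i.-1%:R by rewrite fv mxE.
have fv'E i : f v' 0 i = f v 0 i + (i == i1)%:R by rewrite fv' !mxE.
apply: (swap_symmetric_is_rho'2 u torus_swap_symmetric (A := [set [set u; u']; [set v; v']])).
- by apply/subsetP => x /set2P[]->; apply: edge_of_adj.
- by rewrite cards2; case: eqP.
move=> s s_aut s_A.
have [sigma [e [sigma_inj s_coord s_triv]]] := torus_automorphism s_aut.
have [sU sV] : s @: [set u; u'] \in [set [set u; u']; [set v; v']] /\
               s @: [set v; v'] \in [set [set u; u']; [set v; v']].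
  by split; apply: s_A; rewrite !inE eqxx ?orbT.
have fU x j : x \in [set u; u'] -> j != 0 -> f x 0 j = 0.
  by rewrite !inE => /orP[]/eqP-> j0; rewrite ?fuE // fu'E (negbTE j0).
have fV x j : x \in [set v; v'] -> j != i1 -> f x 0 j = f v 0 j.
  by rewrite !inE => /orP[]/eqP-> j1; rewrite ?fuE // fv'E (negbTE j1) addr0.
have fv0 : f v 0 0 = 0 by rewrite fvE.
have fv1 : f v 0 i1 = 1%:R by rewrite fvE i1E.
have fv'1 : f v' 0 i1 = 2%:R by rewrite fv'E fv1 eqxx -natrD.
have fV1 x : x \in [set v; v'] -> f x 0 i1 <> 0.
  by rewrite !inE => /orP[]/eqP->; rewrite ?fv1 ?fv'1; apply: natr_neq0; lia.
have i1_neq0 : i1 != 0 by rewrite -val_eqE /= i1E.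
have signK (b : bool) (a : 'I_m.+2) : (-1) ^+ b * a = 0 -> a = 0.
  by move/(congr1 ( *%R ((-1) ^+ b))); rewrite mulr0 signrMK.
(* Used to read off the direction of the image of an edge. *)
have sigma_moves x y i : f x 0 i - f y 0 i = 1 -> f (s x) 0 (sigma i) <> f (s y) 0 (sigma i).
  move=> xy1 eq_xy; have := s_coord x y i.
  by rewrite !coordB eq_xy subrr xy1 => /esym/signK/eqP; rewrite oner_eq0.
have [[{}sU {}sV]|[{}sU {}sV]] :
    s @: [set u; u'] = [set u; u'] /\ s @: [set v; v'] = [set v; v'] \/
    s @: [set u; u'] = [set v; v'] /\ s @: [set v; v'] = [set u; u'].
  move: sU sV; rewrite !inE => /orP[]/eqP sU /orP[]/eqP sV; auto.
  - by left; rewrite sV; have /(imset_inj perm_inj) := etrans sU (esym sV).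
  - by right; rewrite sV; have /(imset_inj perm_inj) := etrans sU (esym sV).
all: have [[suE su'E] [svE sv'E]] :
  (s u \in s @: [set u; u'] /\ s u' \in s @: [set u; u']) /\
  (s v \in s @: [set v; v'] /\ s v' \in s @: [set v; v']).
- by rewrite !(mem_imset _ _ perm_inj) !inE !eqxx !orbT.
- rewrite sU in suE su'E; rewrite sV in svE sv'E.
  have sigma0 : sigma 0 = 0.
    have [//|neq] := eqVneq (sigma 0) 0.
    case: (sigma_moves u' u 0); first by rewrite fu'E fuE subr0.
    by rewrite !fU.
  have sigma1 : sigma i1 = i1.
    have [//|neq] := eqVneq (sigma i1) i1.
    case: (sigma_moves v' v i1); first by rewrite fv'E eqxx addrC addKr.
    by rewrite (fV _ _ sv'E) // (fV _ _ svE).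
  (* Since v and u agree in coordinate 0, so do their images; both ends of the second edge have 0
     there, but u' has 1. *)
  have su : s u = u.
    move: suE; rewrite !inE => /orP[]/eqP// su.
    have := s_coord v u 0; rewrite !coordB sigma0 fuE fv0 subr0 mulr0.
    rewrite (fV _ _ svE) ?fv0 1?eq_sym // su fu'E sub0r => /eqP.
    by rewrite oppr_eq0 oner_eq0.
  have su' : s u' = u'.
    move: su'E; rewrite !inE => /orP[]/eqP//; rewrite -{1}su => /perm_inj u'u.
    by have /eqP := fu'E 0; rewrite u'u fuE eq_sym oner_eq0.
  (* In coordinate 1, v - u has entry 1 but v' - u has entry 2. *)
  have sv : s v = v.
    move: svE; rewrite !inE => /orP[]/eqP// sv.
    have := s_coord v u i1; rewrite !coordB su sigma1 fuE !subr0 sv fv'1 fv1.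
    by move=> /sign_natr_inj H; have := H _ _; lia.
  have e0 : e 0 = false.
    apply: (@sign_natr_eq m 1); [by []|lia|].
    by have := s_coord u' u 0; rewrite !coordB su su' sigma0 fuE fu'E subr0.
  have e1 : e i1 = false.
    apply: (@sign_natr_eq m 1); [by []|lia|].
    by have := s_coord v u i1; rewrite !coordB su sv sigma1 fuE fv1 subr0.
  have ord_gt1 (i : 'I_k.+1) : i != 0 -> i != i1 -> f v 0 i = (i.-1)%:R /\ (1 < i < k.+1)%N.
    rewrite -!val_eqE /= i1E fvE => i0 /negbTE i1F; rewrite i1F; split=> //.
    by rewrite ltn_ord andbT; case: (i : nat) i0 i1F => [|[|]].
  (* For i >= 2 the entry i - 1 of v - u lies strictly between 0 and n/2, so it determines both the
     index and the sign. *)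
  have e_sigma i : sigma i = i /\ e i = false.
    have [->//|i0] := eqVneq i 0; have [->//|ineq1] := eqVneq i i1.
    have si0 : sigma i != 0 by rewrite -sigma0 (inj_eq sigma_inj).
    have si1 : sigma i != i1 by rewrite -sigma1 (inj_eq sigma_inj).
    have [fvi i_gt1] := ord_gt1 _ i0 ineq1; have [le_i i_pos lt_i] := half_bound _ i_gt1.
    have [fvsi si_gt1] := ord_gt1 _ si0 si1; have [le_si si_pos _] := half_bound _ si_gt1.
    have := s_coord v u i; rewrite !coordB su sv !fuE !subr0 fvi fvsi => E.
    have pred_eq := sign_natr_inj le_si le_i E.
    split; first by apply: ord_inj; move: pred_eq si_pos i_pos; clear; lia.
    by apply: (sign_natr_eq i_pos lt_i); rewrite -E pred_eq.
  by apply: s_triv => [i|i|]; [case: (e_sigma i)..|exists u].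
- by rewrite !(mem_imset _ _ perm_inj) !inE !eqxx !orbT.
(* If the edges were exchanged, direction 0 would go to direction 1. As v - u vanishes in coordinate
   0, the images of u and v would agree in coordinate 1, which is 0 on the first edge and nonzero on
   the second. *)
- exfalso; rewrite sU in suE su'E; rewrite sV in svE sv'E.
  have sigma0 : sigma 0 = i1.
    have [//|neq] := eqVneq (sigma 0) i1.
    case: (sigma_moves u' u 0); first by rewrite fu'E fuE subr0.
    by rewrite (fV _ _ suE) // (fV _ _ su'E).
  have := s_coord v u 0; rewrite !coordB sigma0 fuE fv0 subr0 mulr0 (fU _ _ svE) //.
  by rewrite sub0r => /eqP; rewrite oppr_eq0 => /eqP; apply: fV1.
Qed.

End CyclePower.

Local Close Scope ring_scope.

(* The pair (n, t) = (5, 1) is excluded from the vertex claim: D(C_5) = 3, so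
   rho(C_5) is undefined. *)
Theorem theorem5p3 (n k t : nat) (hn : 5 <= n) (hk : 0 < k) (ht : 0 < t) :
  (2 <= k <= 1 + n./2 -> is_rho' (cpower (cycle_graph n) k) 2) /\
  (t <= n./2 -> ~ (n = 5 /\ t = 1) -> is_rho (cpower (cycle_graph n) t) 3).
Proof.
(* With n = m + 2 the type ['I_m.+2] is a ring; the exponents become [k.+1] and [t.+1]. *)
case: n hn => [|[|m]] //; rewrite !ltnS => m_ge3.
case: k hk => // k _; case: t ht => // t _; split.
  have [f f_bij f_adj] := cpower_cycle_coords m k.
  by rewrite add1n !ltnS; apply: (torus_is_rho'2 m_ge3 f_bij f_adj).
have [f f_bij f_adj] := cpower_cycle_coords m t.
(* After the shift, t = 0 is the cycle itself, where excluding n = 5 yields n >= 6. *)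
move=> t_lt not51; have [t0|t_gt0] := posnP t.
  by apply: (torus1_is_rho3 m_ge3 f_bij f_adj) => //; lia.
exact: (torus_is_rho3 m_ge3 f_bij f_adj).
Qed.
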